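(* Let $\Omega$ be an eventually outward finitely branched tree quiver, $V$ a representation of $\Omega$ over a field, and for $\alpha\in\mathcal{C}$ let $W^\alpha=F^\alpha/\sum_{\beta<\alpha}F^\beta$. Let $\alpha\in\mathcal{C}$. For each arrow $e$ in $\alpha$, if there is exactly one virtual boundary arrow of $\Omega$ behind $e$, then the map induced by $f_e$ from $W^\alpha_{s(e)}$ to $W^\alpha_{t(e)}$ is bijective. For each vertex $i$ not in $\alpha$, $W^\alpha_i=\{0\}$.
   Context: A quiver $\Omega$ consists of a set $\Omega_0$ of vertices, a set $\Omega_1$ of arrows, and source and target functions $s,t:\Omega_1\to\Omega_0$. It is a tree if its underlying undirected graph is a tree (at most one arrow between two vertices, no loops). A walk is a map $w$ from a finite or infinite interval of $\mathbb{Z}$ to $\Omega_0$ with consecutive values joined by an arrow $e$; $e$ is oriented consistently if $s(e)=w_i,\ t(e)=w_{i+1}$, inconsistently if $s(e)=w_{i+1},\ t(e)=w_i$. A journey is a walk whose interval has a minimal element. $\Omega$ is finitely branched if it is a union of finitely many injective walks, and eventually outward if every injective journey contains at most finitely many arrows oriented inconsistently. Removing an arrow $e$ splits $\Omega$ into two connected subquivers: the one containing $t(e)$ is in front of $e$, and the one containing $s(e)$ is behind $e$. Anything contained in the former (latter) is in front of (behind) $e$, and $e$ points towards (away from) it. $\mathcal{C}$ is the set of (nonempty) connected full subquivers of $\Omega$. A boundary arrow of $\alpha\in\mathcal{C}$ is an arrow with exactly one endpoint in $\alpha$; $\mathrm{iba}(\alpha)$ (resp. $\mathrm{oba}(\alpha)$)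 is the set of those pointing towards (resp. away from) $\alpha$. $\beta$ is a reduction of $\alpha$ if there is an arrow $e$ in $\alpha$ such that $\beta$ is the portion of $\alpha$ behind $e$; $\beta$ is an enhancement of $\alpha$ if there is an arrow $e$ in $\beta$ such that $\alpha$ is the portion of $\beta$ in front of $e$. Write $\alpha>\beta$ if $\beta$ is obtained from $\alpha$ by a finite sequence of one or more such moves. A representation $V$ consists of vector spaces $V_i$ ($i\in\Omega_0$) and linear maps $f_e:V_{s(e)}\to V_{t(e)}$ ($e\in\Omega_1$). The transport of a subspace of $V_i$ to a vertex $j$ follows the unique injective walk from $i$ to $j$, taking the image under $f_e$ when $e$ is crossed from $s(e)$ to $t(e)$ and the preimage under $f_e$ when $e$ is crossed from $t(e)$ to $s(e)$. For an arrow $e$: $V^{e,+}_i=V_i$ if $i$ is behind $e$, and otherwise the transport of $V_{t(e)}$ from $t(e)$ to $i$; $V^{e,-}_i=0$ if $i$ is in front of $e$, and otherwise the transport of $\{0\}\subseteq V_{t(e)}$ to $i$. These are subrepresentations of $V$. A virtual arrow $E$ is an injective journey with all arrows oriented away from its start, which is either infinite or ends in a leaf of $\Omega$ (possibly a single leaf vertex). $V^{E,+}_i=V_i$ if $i\in E$, and otherwise the transport to $i$ of $V_j$, with $j$ the vertex of $E$ closest to $i$. Virtual arrows that differ only in where they start (one is an end segment of the other) define the same subrepresentation and are counted as the same. If $E$ lies entirely in $\alpha$ it is a virtual boundary arrow of $\alpha$ (in particular every virtual arrow is a virtual boundary arrow of $\Omega$); $E$ is behind $e$ if, after possibly passing to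 an end segment, it lies in the subquiver behind $e$. For $\alpha\in\mathcal{C}$, $F^\alpha$ is the intersection of all $V^{e,+}$ for $e\in\mathrm{iba}(\alpha)$, all $V^{e,-}$ for $e\in\mathrm{oba}(\alpha)$, and all $V^{E,+}$ for $E$ a virtual boundary arrow of $\alpha$. One has $F^\beta\subseteq F^\alpha$ for $\beta\le\alpha$. *)

(* Defs.v *)
From Stdlib Require Import Relations.
From mathcomp Require Import all_boot all_order all_algebra.
From mathcomp Require Import all_classical.

Set Implicit Arguments.
Unset Strict Implicit.
Unset Printing Implicit Defensive.

Import Order.TTheory GRing.Theory Num.Theory.
Local Open Scope classical_set_scope.
Local Open Scope ring_scope.

(** * Quivers and trees *)

Record quiver := Quiver {
  vertex :> Type;
  arrow : Type;
  src : arrow -> vertex;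
  tgt : arrow -> vertex }.

Definition joins (Q : quiver) (e : arrow Q) (i j : Q) : Prop :=
  (src e = i /\ tgt e = j) \/ (src e = j /\ tgt e = i).

(* A finite walk from [i] to [j], remembering the arrows crossed: [fwd e p]
   prolongs [p] across [e] from [src e] to [tgt e], and [bwd e p] from [tgt e]
   to [src e].  Recursion on routes gives transport of subspaces without
   casts. *)
Inductive route (Q : quiver) (i : Q) : Q -> Type :=
  | stay : route i i
  | fwd (e : arrow Q) : route i (src e) -> route i (tgt e)
  | bwd (e : arrow Q) : route i (tgt e) -> route i (src e).

Fixpoint visited (Q : quiver) (i j : Q) (p : route i j) : set Q :=
  match p with
  | stay => [set i]
  | fwd e q => visited q `|` [set tgt e]
  | bwd e q => visited q `|` [set src e]
  end.

Fixpoint injective_route (Q : quiver) (i j : Q) (p : route i j) : Prop :=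
  match p with
  | stay => True
  | fwd e q => injective_route q /\ ~ visited q (tgt e)
  | bwd e q => injective_route q /\ ~ visited q (src e)
  end.

Fixpoint route_length (Q : quiver) (i j : Q) (p : route i j) : nat :=
  match p with
  | stay => 0%N
  | fwd _ q => (route_length q).+1
  | bwd _ q => (route_length q).+1
  end.

Fixpoint avoids (Q : quiver) (e : arrow Q) (i j : Q) (p : route i j) : Prop :=
  match p with
  | stay => True
  | fwd e' q => e' <> e /\ avoids e q
  | bwd e' q => e' <> e /\ avoids e q
  end.

Definition connected (Q : quiver) (A : set Q) : Prop :=
  forall i j, A i -> A j -> exists p : route i j, visited p `<=` A.

Definition no_cycle (Q : quiver) : Prop :=
  forall (i j : Q) (p : route i j) (e : arrow Q),
    injective_route p -> (2 <= route_length p)%N -> ~ joins e j i.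

Definition is_tree (Q : quiver) : Prop :=
  [/\ forall e : arrow Q, src e <> tgt e,
      forall (e e' : arrow Q) (i j : Q), joins e i j -> joins e' i j -> e = e',
      connected [set: Q]
    & no_cycle Q].

(** * Possibly infinite walks *)

(* The values of [at_] outside [dom] are irrelevant. *)
Record walk (Q : quiver) := Walk {
  dom : set int;
  at_ : int -> Q;
  dom_convex : forall x y z : int, dom x -> dom z -> x <= y <= z -> dom y;
  walk_joins : forall z, dom z -> dom (z + 1) ->
    exists e : arrow Q, joins e (at_ z) (at_ (z + 1)) }.

Section Walks.
Context {Q : quiver}.
Implicit Types (w : walk Q) (e : arrow Q) (A : set Q).

Definition walk_vertices w : set Q := at_ w @` dom w.

Definition oriented_consistently w e : Prop :=
  exists z, [/\ dom w z, dom w (z + 1), src e = at_ w z & tgt e = at_ w (z + 1)].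

Definition oriented_inconsistently w e : Prop :=
  exists z, [/\ dom w z, dom w (z + 1), src e = at_ w (z + 1) & tgt e = at_ w z].

Definition walk_arrows w : set (arrow Q) :=
  [set e | oriented_consistently w e \/ oriented_inconsistently w e].

Definition injective_walk w : Prop :=
  forall x y, dom w x -> dom w y -> at_ w x = at_ w y -> x = y.

Definition journey w : Prop :=
  exists m, dom w m /\ forall z, dom w z -> m <= z.

End Walks.

Definition finitely_branched (Q : quiver) : Prop :=
  exists (n : nat) (w : 'I_n -> walk Q),
    [/\ forall k, injective_walk (w k),
        forall i : Q, exists k, walk_vertices (w k) i
      & forall e : arrow Q, exists k, walk_arrows (w k) e].

Definition eventually_outward (Q : quiver) : Prop :=
  forall w : walk Q, injective_walk w -> journey w ->
    finite_set [set e | oriented_inconsistently w e].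

(** * Connected full subquivers, given by their sets of vertices *)

Record csub (Q : quiver) := Csub {
  csub_set :> set Q;
  csub_nonempty : csub_set !=set0;
  csub_connected : connected csub_set }.

Section Subquivers.
Context {Q : quiver}.
Implicit Types (e : arrow Q) (A : set Q) (alpha beta : csub Q).

Definition arrow_in A e : Prop := A (src e) /\ A (tgt e).

(* The two components left after removing [e]. *)
Definition front e : set Q :=
  [set i | exists p : route (tgt e) i, avoids e p].
Definition behind e : set Q :=
  [set i | exists p : route (src e) i, avoids e p].

Definition boundary_arrow A e : Prop :=
  (A (src e) /\ ~ A (tgt e)) \/ (~ A (src e) /\ A (tgt e)).

Definition iba A : set (arrow Q) :=
  [set e | boundary_arrow A e /\ A `<=` front e].
Definition oba A : set (arrow Q) :=
  [set e | boundary_arrow A e /\ A `<=` behind e].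

Definition reduction beta alpha : Prop :=
  exists e, arrow_in alpha e /\ csub_set beta = alpha `&` behind e.
Definition enhancement beta alpha : Prop :=
  exists e, arrow_in beta e /\ csub_set alpha = beta `&` front e.

Definition csub_lt : csub Q -> csub Q -> Prop :=
  clos_trans (csub Q)
    (fun beta alpha => reduction beta alpha \/ enhancement beta alpha).

Definition leaf (i : Q) : Prop := exists! e, src e = i \/ tgt e = i.

End Subquivers.

(** * Virtual arrows *)

Record virtual_arrow (Q : quiver) := VirtualArrow {
  va_walk :> walk Q;
  va_injective : injective_walk va_walk;
  va_journey : journey va_walk;
  va_outward : forall e, walk_arrows va_walk e -> oriented_consistently va_walk e;
  va_end : infinite_set (dom va_walk) \/
    exists m, [/\ dom va_walk m, forall z, dom va_walk z -> z <= m
                & leaf (at_ va_walk m)] }.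

Section VirtualArrows.
Context {Q : quiver}.
Implicit Types (E : virtual_arrow Q) (e : arrow Q) (A : set Q).

(* [E'] is an end segment of [E], up to a translation [k] of the indexing. *)
Definition end_segment E' E : Prop :=
  exists k m : int,
    (forall z, dom E' z <-> m <= z /\ dom E (z + k)) /\
    (forall z, dom E' z -> at_ E' z = at_ E (z + k)).

(* Being an end segment of one another is not transitive (two virtual arrows
   may merge), whence the generated equivalence. *)
Definition same_virtual_arrow : virtual_arrow Q -> virtual_arrow Q -> Prop :=
  clos_refl_sym_trans (virtual_arrow Q) end_segment.

Definition virtual_boundary_arrow A E : Prop := walk_vertices E `<=` A.

Definition virtual_behind e E : Prop :=
  exists E', end_segment E' E /\ walk_vertices E' `<=` behind e.

Definition exactly_one_virtual_behind e : Prop :=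
  exists E, [/\ virtual_boundary_arrow [set: Q] E, virtual_behind e E
    & forall E', virtual_boundary_arrow [set: Q] E' -> virtual_behind e E' ->
        same_virtual_arrow E E'].

Definition closest E (i j : Q) : Prop :=
  walk_vertices E j /\
  exists p : route j i, forall j', walk_vertices E j' ->
    forall p' : route j' i, (route_length p <= route_length p')%N.

End VirtualArrows.

(** * Representations *)

Record representation (K : fieldType) (Q : quiver) := Representation {
  space :> Q -> lmodType K;
  rmap : forall e : arrow Q, {linear space (src e) -> space (tgt e)} }.

Section Filtration.
Context {K : fieldType} {Q : quiver} (V : representation K Q).
Implicit Types (e : arrow Q) (E : virtual_arrow Q) (alpha beta : csub Q).

Fixpoint transport_along (i j : Q) (p : route i j) (U : set (V i)) : set (V j) :=
  match p with
  | stay => U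
  | fwd e q => rmap V e @` transport_along q U
  | bwd e q => rmap V e @^-1` transport_along q U
  end.

(* In a tree, [p] exists and is unique. *)
Definition transport (i : Q) (U : set (V i)) (j : Q) : set (V j) :=
  [set x | exists p : route i j, injective_route p /\ transport_along p U x].
Arguments transport {i} U j.

Definition Vplus e (i : Q) : set (V i) :=
  if `[< behind e i >] then setT else transport [set: V (tgt e)] i.

Definition Vminus e (i : Q) : set (V i) :=
  if `[< front e i >] then [set 0] else transport [set (0 : V (tgt e))] i.

Arguments Vplus e i : clear implicits.
Arguments Vminus e i : clear implicits.

(* In a tree, the closest vertex [j] exists and is unique. *)
Definition Vvirtual E (i : Q) : set (V i) :=
  if `[< walk_vertices E i >] then setT
  else [set x | exists j, closest E i j /\ transport [set: V j] i x].

Arguments Vvirtual E i : clear implicits.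

Definition F alpha (i : Q) : set (V i) :=
  [set x | [/\ forall e, iba alpha e -> Vplus e i x,
               forall e, oba alpha e -> Vminus e i x
             & forall E, virtual_boundary_arrow alpha E -> Vvirtual E i x]].

Arguments F alpha i : clear implicits.

(* The sum of the subspaces [F beta i] for [beta < alpha]. *)
Definition Fsum alpha (i : Q) : set (V i) :=
  [set x | exists (n : nat) (b : 'I_n -> csub Q) (v : 'I_n -> V i),
     (forall k, csub_lt (b k) alpha /\ F (b k) i (v k)) /\ x = \sum_(k < n) v k].

Arguments Fsum alpha i : clear implicits.

Definition coset (M : lmodType K) (N : set M) (x : M) : set M :=
  [set y | N (y - x)].

(* The quotient [F alpha i / Fsum alpha i], as the set of cosets. *)
Definition W alpha (i : Q) : set (set (V i)) := coset (Fsum alpha i) @` F alpha i.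

Arguments W alpha i : clear implicits.

(* The map induced by [rmap V e] on cosets: [x + N] is sent to
   [rmap V e (x + N) + N'], which is the coset of [rmap V e x] whenever
   [rmap V e] maps [N] into [N']. *)
Definition Wmap alpha e (c : set (V (src e))) : set (V (tgt e)) :=
  [set y | exists2 x, c x & Fsum alpha (tgt e) (y - rmap V e x)].

End Filtration.

Arguments transport {K Q} V {i} U j.
Arguments Vplus {K Q} V e i.
Arguments Vminus {K Q} V e i.
Arguments Vvirtual {K Q} V E i.
Arguments F {K Q} V alpha i.
Arguments Fsum {K Q} V alpha i.
Arguments W {K Q} V alpha i.
Arguments Wmap {K Q} V alpha e c.

(* Main.v *)
Require Import Defs.
From mathcomp Require Import all_boot all_order all_algebra.
From mathcomp Require Import all_classical.
From mathcomp Require Import zify.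
From Stdlib Require Import Relations Eqdep.
Local Open Scope classical_set_scope.
Local Open Scope ring_scope.

(** The space [F V A i] is cut out by one condition for each _end_ of [A]: an
incoming boundary arrow, an outgoing one, or a virtual arrow inside [A].  When an
end lies on one side of an arrow [e], its condition at the far endpoint of [e] is
the image, or the preimage, of its condition at the near endpoint, because every
transport to the other side passes through [e] (on_side_step).

_Vertices outside A._  If [i] is not in [A], some boundary arrow [e] of [A]
separates it from [A].  If [e] is outgoing, its condition at [i] is the zero
space.  If [e] is incoming, enlarge [A] by everything that can be reached from
[src e] along arrows without crossing [e].  All new ends are reached from [src e]
by going forward along arrows, and the full space pulls back to the full space, so
each new condition contains the transport to [i] of the full space at [src e].
Since [A] also has an end in front of [e] (exists_end, which rests on the
existence of a virtual arrow on each side of each arrow, side_virtual), [F V A i]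
lies in that transport.  Hence [F V A i] is contained in [F V B i] for a smaller
[B] (F_behind).

_Arrows inside A._  Suppose that there is a single virtual arrow behind [e].
Since a boundary arrow cuts off a part that contains a virtual arrow, any [A]
containing [e] has exactly one end behind [e] (unique_end).  Let [L] be its
condition at [src e], let [R] be the intersection at [tgt e] of the conditions from
the ends in front of [e], and let [f] be [rmap V e].  Then [F] is the
intersection of [L] and [f^-1(R)] at [src e], and that of [f(L)] and [R] at
[tgt e], so [f] maps the former onto the latter (F_lift).  This gives
surjectivity.

For injectivity, the terms [F V B (tgt e)] with [B < A] that make up the
denominator also have to be lifted.  If [B] contains [e], F_lift applies to it.
Otherwise [e] was cut off by a reduction, [B] has an outgoing boundary arrow
pointing towards [e] (lt_loses), and [F V B (tgt e)] is zero.  So an element of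
[F V A (src e)] that maps into the denominator agrees, up to the denominator,
with an element of [F V A (src e)] killed by [f], using that [F] is monotone
(F_lt); and such an element lies in [F] of the reduction of [A] along [e]
(F_kernel). *)

Import Order.TTheory GRing.Theory Num.Theory.

Set Implicit Arguments.
Unset Strict Implicit.

(** * Routes *)

Section Routes.
Context {Q : quiver}.
Implicit Types (e : arrow Q) (A : set Q).

Fixpoint rcat (i j k : Q) (p : route i j) (q : route j k) : route i k :=
  match q in route _ k return route i k with
  | stay => p
  | fwd e q' => fwd (rcat p q')
  | bwd e q' => bwd (rcat p q')
  end.

Fixpoint rrev (i j : Q) (p : route i j) : route j i :=
  match p in route _ j return route j i with
  | stay => stay i
  | fwd e q => rcat (bwd (stay (tgt e))) (rrev q)
  | bwd e q => rcat (fwd (stay (src e))) (rrev q)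
  end.

Lemma avoids_rcat e (i j k : Q) (p : route i j) (q : route j k) :
  avoids e (rcat p q) <-> avoids e p /\ avoids e q.
Proof. by elim: q => [|e' q IH|e' q IH] //=; [tauto| rewrite IH; tauto..]. Qed.

Lemma avoids_rrev e (i j : Q) (p : route i j) : avoids e (rrev p) <-> avoids e p.
Proof.
by elim: p => [|e' q IH|e' q IH] //=; rewrite avoids_rcat IH /=; tauto.
Qed.

Lemma visited_end (i j : Q) (p : route i j) : visited p j.
Proof. by case: p => [|e q|e q] //=; right. Qed.

Lemma visited_start (i j : Q) (p : route i j) : visited p i.
Proof. by elim: p => [|e q IH|e q IH] //=; left. Qed.

Lemma visited_rcat (i j k : Q) (p : route i j) (q : route j k) v :
  visited (rcat p q) v -> visited p v \/ visited q v.
Proof.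
elim: q => [|e q IH|e q IH] /=; first by left.
- by case=> [/IH[]|->]; [left|right; left|right; right].
- by case=> [/IH[]|->]; [left|right; left|right; right].
Qed.

Lemma visited_rrev (i j : Q) (p : route i j) : visited (rrev p) `<=` visited p.
Proof.
elim: p => [|e q IH|e q IH] //= v /visited_rcat[] /=.
- by case=> ->; [right|left; exact: visited_end].
- by move=> /IH; left.
- by case=> ->; [right|left; exact: visited_end].
- by move=> /IH; left.
Qed.

Lemma injective_rcat (i j k : Q) (p : route i j) (q : route j k) :
  injective_route p -> injective_route q ->
  (forall v, visited p v -> visited q v -> v = j) -> injective_route (rcat p q).
Proof.
move=> injp; elim: q => [|e q IH|e q IH] //= [injq nq] pq.
- split; first by apply: IH => // v pv qv; apply: pq => //; left.
  move=> /visited_rcat[pv|//]; apply: nq.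
  by rewrite (pq _ pv); [exact: visited_start|right].
- split; first by apply: IH => // v pv qv; apply: pq => //; left.
  move=> /visited_rcat[pv|//]; apply: nq.
  by rewrite (pq _ pv); [exact: visited_start|right].
Qed.

Lemma route_prefix (i j : Q) (p : route i j) k : visited p k ->
  exists q : route i k, [/\ injective_route p -> injective_route q,
    visited q `<=` visited p & forall e, avoids e p -> avoids e q].
Proof.
elim: p => [|e p IH|e p IH] /=.
- by move=> ->; exists (stay i); split.
- case=> [/IH[q [qi qv qa]]|->].
  + by exists q; split=> [[/qi]//|v /qv|e' [_ /qa]] //; left.
  + by exists (fwd p); split.
- case=> [/IH[q [qi qv qa]]|->].
  + by exists q; split=> [[/qi]//|v /qv|e' [_ /qa]] //; left.
  + by exists (bwd p); split.
Qed.

Lemma injective_route_of (i j : Q) (p : route i j) :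
  exists q : route i j, [/\ injective_route q,
    visited q `<=` visited p & forall e, avoids e p -> avoids e q].
Proof.
elim: p => [|e p [q [qi qv qa]]|e p [q [qi qv qa]]] /=.
- by exists (stay i); split.
- have [/route_prefix[r [ri rv ra]]|nq] := pselect (visited q (tgt e)).
  + exists r; split=> [|v /rv /qv|e' [_ /qa /ra]]//; [exact: ri|by left].
  + exists (fwd q); split=> //= [v [/qv|]|e' [? /qa]] //; by [left|right].
- have [/route_prefix[r [ri rv ra]]|nq] := pselect (visited q (src e)).
  + exists r; split=> [|v /rv /qv|e' [_ /qa /ra]]//; [exact: ri|by left].
  + exists (bwd q); split=> //= [v [/qv|]|e' [? /qa]] //; by [left|right].
Qed.

Lemma visited_avoids e (i j : Q) (p : route i j) :
  ~ (visited p (src e) /\ visited p (tgt e)) -> avoids e p.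
Proof.
elim: p => [|e' p IH|e' p IH] //= H; split.
- by move=> E; apply: H; rewrite -E; split; [left; exact: visited_end|right].
- by apply: IH => -[? ?]; apply: H; split; left.
- by move=> E; apply: H; rewrite -E; split; [right|left; exact: visited_end].
- by apply: IH => -[? ?]; apply: H; split; left.
Qed.

Lemma route_length0 (i j : Q) (p : route i j) : route_length p = 0%N -> i = j.
Proof. by case: p. Qed.

Lemma route_length1 e (i j : Q) (p : route i j) : route_length p = 1%N ->
  avoids e p -> exists e', e' <> e /\ joins e' i j.
Proof.
case: p => [|e' p|e' p] //= [/route_length0 E] [ne _];
  by exists e'; split=> //; rewrite E; first [by left | by right].
Qed.

End Routes.

(** * The two sides of an arrow of a tree *)

Section Sides.
Context {Q : quiver}.
Implicit Types (e : arrow Q) (A : set Q).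

Definition side e (b : bool) : set Q := if b then front e else behind e.
Definition endpoint e (b : bool) : Q := if b then tgt e else src e.

Definition crossing e (b : bool) : route (endpoint e b) (endpoint e (~~ b)) :=
  if b return route (endpoint e b) (endpoint e (~~ b))
  then bwd (stay (tgt e)) else fwd (stay (src e)).

Lemma sideP e b i : side e b i <-> exists p : route (endpoint e b) i, avoids e p.
Proof. by case: b. Qed.

Lemma side_endpoint e b : side e b (endpoint e b).
Proof. by apply/sideP; exists (stay _). Qed.

Lemma side_route e b (i j : Q) (p : route i j) :
  side e b i -> avoids e p -> side e b j.
Proof.
move=> /sideP[q qa] pa; apply/sideP; exists (rcat q p).
by rewrite avoids_rcat.
Qed.

Lemma side_visited e b (i j : Q) (p : route i j) :
  side e b i -> avoids e p -> visited p `<=` side e b.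
Proof.
move=> si pa v /route_prefix[q [_ _ /(_ e pa) qa]]; exact: side_route si qa.
Qed.

Lemma side_cross e b h c : h <> e -> side e b (endpoint h c) ->
  side e b (endpoint h (~~ c)).
Proof.
case: c => ne s.
- exact: (side_route (p := crossing h true) s).
- exact: (side_route (p := crossing h false) s).
Qed.

End Sides.

Section TreeSides.
Context {Q : quiver} (Qtree : is_tree Q).
Implicit Types (e : arrow Q) (A : set Q).

Lemma src_neq_tgt e : src e <> tgt e.
Proof. by case: Qtree. Qed.

Lemma side_cover e b i : side e b i \/ side e (~~ b) i.
Proof.
have [_ _ /(_ (endpoint e b) i I I) [p _] _] := Qtree.
elim: p => [|h p IH|h p IH]; first by left; exact: side_endpoint.
- have [->|ne] := pselect (h = e).
    by case: b {p IH}; [left; exact: (side_endpoint e true)|right; exact: (side_endpoint e true)].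
  by case: IH => s; [left|right]; exact: (side_cross (c := false) ne s).
- have [->|ne] := pselect (h = e).
    by case: b {p IH}; [right; exact: (side_endpoint e false)|left; exact: (side_endpoint e false)].
  by case: IH => s; [left|right]; exact: (side_cross (c := true) ne s).
Qed.

Lemma front_behind e i : front e i -> behind e i -> False.
Proof.
have [loop mult _ cyc] := Qtree.
move=> [p pa] [q qa].
have ra : avoids e (rcat q (rrev p)) by rewrite avoids_rcat avoids_rrev.
have [r [ri _ /(_ e ra)]] := injective_route_of (rcat q (rrev p)).
case E: (route_length r) => [|[|n]] raa.
- by apply: (loop e); exact: route_length0 E.
- have [e' [ne J]] := route_length1 E raa.
  by apply: ne; apply: mult J _; left.
- by apply: (cyc _ _ r e ri); rewrite ?E //; right.
Qed.

Lemma side_disj e b i : side e b i -> side e (~~ b) i -> False.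
Proof. by case: b => /= ? ?; apply: (@front_behind e i). Qed.

Lemma sideN e b i : ~ side e b i -> side e (~~ b) i.
Proof. by case: (side_cover e b i). Qed.

Lemma endpoint_notin e b : ~ side e (~~ b) (endpoint e b).
Proof. exact: side_disj (side_endpoint e b). Qed.

Lemma endpointN_notin e b : ~ side e b (endpoint e (~~ b)).
Proof. by have := @endpoint_notin e (~~ b); rewrite negbK. Qed.

(** Routes inside a set that misses an endpoint of [e] cannot cross [e]. *)
Lemma connected_side A e b i :
  connected A -> ~ arrow_in A e -> A i -> side e b i -> A `<=` side e b.
Proof.
move=> cA nA Ai si j Aj; have [p pA] := cA _ _ Ai Aj.
by apply: (side_route si (p := p)); apply: visited_avoids => -[/pA ? /pA ?]; apply: nA.
Qed.

Lemma side_inj_route e b (i j : Q) : side e b i -> side e b j ->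
  exists p : route i j, injective_route p /\ visited p `<=` side e b.
Proof.
move=> si /sideP[q qa]; have /sideP[p pa] := si.
have ra : avoids e (rcat (rrev p) q) by rewrite avoids_rcat avoids_rrev.
have [r [ri _ /(_ e ra) raa]] := injective_route_of (rcat (rrev p) q).
by exists r; split=> //; exact: side_visited si raa.
Qed.

Lemma side_connected e b : connected (side e b).
Proof.
by move=> i j si sj; have [p [_ pv]] := side_inj_route si sj; exists p.
Qed.

Lemma arrow_in_endpoint A e : arrow_in A e <-> forall b, A (endpoint e b).
Proof. by split=> [[? ?] []|H] //; split; [exact: (H false)|exact: (H true)]. Qed.

(** On a walk without backtracking that crosses [e] and then [h], the parts ahead
are nested. *)
Lemma side_next e b h c : h <> e -> endpoint h (~~ c) = endpoint e b ->
  side h c `<=` side e b.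
Proof.
move=> ne E; have sh : side e b (endpoint h c).
  rewrite -(negbK c); apply: side_cross => //; rewrite E; exact: side_endpoint.
apply: connected_side sh; [exact: side_connected| |exact: side_endpoint].
by move=> /arrow_in_endpoint/(_ b); rewrite -E -{1}(negbK c); exact: endpoint_notin.
Qed.

Lemma arrow_side e b h : h <> e -> arrow_in (side e b) h \/ arrow_in (side e (~~ b)) h.
Proof.
by move=> ne; case: (side_cover e b (src h)) => s; [left|right];
  split=> //; exact: (side_cross (c := false) ne s).
Qed.

Lemma tgt_route_behind e i (p : route i (src e)) :
  ~ visited p (tgt e) -> behind e i.
Proof.
move=> np; exists (rrev p); rewrite avoids_rrev.
by apply: visited_avoids => -[].
Qed.

Lemma src_route_front e i (p : route i (tgt e)) :
  ~ visited p (src e) -> front e i.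
Proof.
move=> np; exists (rrev p); rewrite avoids_rrev.
by apply: visited_avoids => -[].
Qed.

(** The last arrow [e] of an injective route is determined by the endpoints: the
route shows its start to be on the near side of [e], while a route that arrives
through another arrow avoids [e] and would put its start on the far side.  The
dependent pairs allow case analysis on both routes. *)
Lemma injective_route_unique_sig i (j j' : Q) (p : route i j) (p' : route i j') :
  injective_route p -> injective_route p' -> j = j' ->
  existT (route i) j p = existT (route i) j' p'.
Proof.
move=> + + ; elim: p j' p' => [|e p IH|e p IH] j' [|e' p'|e' p'] //=.
- by move=> _ [_ np'] E; case: np'; rewrite -E; exact: visited_start.
- by move=> _ [_ np'] E; case: np'; rewrite -E; exact: visited_start.
- by move=> [_ np] _ E; case: np; rewrite E; exact: visited_start.
- move=> [ip np] [ip' np'] E; have [ee|ne] := pselect (e' = e).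
    rewrite ee in p' ip' np' E *.
    have pp := IH _ p' ip ip' erefl.
    by rewrite (inj_pair2 _ _ _ _ _ pp).
  have si := tgt_route_behind np.
  have av : avoids e (fwd p').
    split=> //; apply: visited_avoids => -[_]; rewrite E; exact: np'.
  case: (@side_disj e false (tgt e)).
    rewrite E; exact: (side_route (b := false) si av).
  exact: (side_endpoint e true).
- move=> [ip np] [ip' np'] E; have ne : e' <> e.
    by move=> ee; apply: (src_neq_tgt (e := e)); rewrite E ee.
  have si := tgt_route_behind np.
  have av : avoids e (bwd p').
    split=> //; apply: visited_avoids => -[_]; rewrite E; exact: np'.
  case: (@side_disj e false (tgt e)).
    rewrite E; exact: (side_route (b := false) si av).
  exact: (side_endpoint e true).
- by move=> [_ np] _ E; case: np; rewrite E; exact: visited_start.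
- move=> [ip np] [ip' np'] E; have ne : e' <> e.
    by move=> ee; apply: (src_neq_tgt (e := e)); rewrite E ee.
  have si := src_route_front np.
  have av : avoids e (fwd p').
    split=> //; apply: visited_avoids => -[+ _]; rewrite E; exact: np'.
  case: (@side_disj e true (src e)).
    rewrite E; exact: (side_route (b := true) si av).
  exact: (side_endpoint e false).
- move=> [ip np] [ip' np'] E; have [ee|ne] := pselect (e' = e).
    rewrite ee in p' ip' np' E *.
    have pp := IH _ p' ip ip' erefl.
    by rewrite (inj_pair2 _ _ _ _ _ pp).
  have si := src_route_front np.
  have av : avoids e (bwd p').
    split=> //; apply: visited_avoids => -[+ _]; rewrite E; exact: np'.
  case: (@side_disj e true (src e)).
    rewrite E; exact: (side_route (b := true) si av).
  exact: (side_endpoint e false).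
Qed.

Lemma injective_route_unique (i j : Q) (p p' : route i j) :
  injective_route p -> injective_route p' -> p = p'.
Proof.
by move=> ip ip'; apply: inj_pair2 (injective_route_unique_sig ip ip' erefl).
Qed.

End TreeSides.

(** * Transport *)

Section Transport.
Context {K : fieldType} {Q : quiver} (Qtree : is_tree Q) (V : representation K Q).
Implicit Types (e : arrow Q).

Lemma transport_along_rcat (i j k : Q) (p : route i j) (q : route j k) (U : set (V i)) :
  transport_along (rcat p q) U = transport_along q (transport_along p U).
Proof. by elim: q => [|e q IH|e q IH] //=; rewrite IH. Qed.

Lemma transport_along_mono (i j : Q) (p : route i j) (U U' : set (V i)) :
  U `<=` U' -> transport_along p U `<=` transport_along p U'.
Proof.
move=> UU; elim: p => [|e p IH|e p IH] //=; first exact: image_subset.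
move=> x; exact: IH.
Qed.

Lemma transportE (i j : Q) (p : route i j) (U : set (V i)) :
  injective_route p -> transport V U j = transport_along p U.
Proof.
move=> ip; apply/seteqP; split=> [x [q [iq]]|x px]; last by exists p.
by rewrite (injective_route_unique Qtree iq ip).
Qed.

Lemma transport_id (i : Q) (U : set (V i)) : transport V U i = U.
Proof. by rewrite (transportE (p := stay i)). Qed.

Lemma transport_mono (i j : Q) (U U' : set (V i)) :
  U `<=` U' -> transport V U j `<=` transport V U' j.
Proof. move=> UU x [p [ip px]]; exists p; split=> //; exact: transport_along_mono px. Qed.

(** Image under [rmap V e] for [b = false], preimage for [b = true]. *)
Definition cross e b (U : set (V (endpoint e b))) : set (V (endpoint e (~~ b))) :=
  transport_along (crossing e b) U.

(** The sides of [e] are disjoint, so injective routes inside them can be joined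
by the crossing of [e] to an injective route. *)
Lemma transport_split e b (j i : Q) (U : set (V j)) :
  side e b j -> side e (~~ b) i ->
  transport V U i = transport V (cross (transport V U (endpoint e b))) i.
Proof.
move=> sj si.
have [p [ip pv]] := side_inj_route sj (side_endpoint e b).
have [q [iq qv]] := side_inj_route (side_endpoint e (~~ b)) si.
have ic : injective_route (rcat p (crossing e b)).
  have ec : forall v, visited p v -> v <> endpoint e (~~ b).
    by move=> v /pv sv E; apply: (side_disj Qtree sv); rewrite E; exact: side_endpoint.
  by case: b p {sj si pv q iq qv} ip ec => p ip ec; split=> //= pv; exact: (ec _ pv).
have vc v : visited (rcat p (crossing e b)) v -> visited p v \/ v = endpoint e (~~ b).
  by clear; case: b p => p [vp|->]; [left|right|left|right].
have ir : injective_route (rcat (rcat p (crossing e b)) q).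
  apply: injective_rcat => // v /vc[/pv sv /qv sv'|//].
  by case: (side_disj Qtree sv sv').
by rewrite (transportE _ ir) !transport_along_rcat (transportE _ iq) (transportE _ ip).
Qed.

Lemma transport_step e b (j : Q) (U : set (V j)) : side e b j ->
  transport V U (endpoint e (~~ b)) = cross (transport V U (endpoint e b)).
Proof.
by move=> sj; rewrite (transport_split U sj (side_endpoint _ _)) transport_id.
Qed.

Lemma transport_endpoint e b i (U : set (V (endpoint e b))) : side e (~~ b) i ->
  transport V U i = transport V (cross U) i.
Proof.
by move=> si; rewrite (transport_split U (side_endpoint _ _) si) transport_id.
Qed.

Definition full (j i : Q) : set (V i) := transport V [set: V j] i.

Arguments full : clear implicits.

Lemma full_id i x : full i i x.
Proof. by rewrite /full transport_id. Qed.

(** Against an arrow the full space is transported to the full space, so the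
transport of the full space grows when its starting point moves along an
arrow. *)
Lemma full_arrow e i : full (src e) i `<=` full (tgt e) i.
Proof.
rewrite /full; case: (side_cover Qtree e true i) => si.
- rewrite (transport_endpoint (e := e) (b := false)) //; exact: transport_mono.
- rewrite [X in _ `<=` X](transport_endpoint (e := e) (b := true)) //.
Qed.

Lemma full_behind e i : behind e i -> full (tgt e) i `<=` full (src e) i.
Proof.
move=> si; rewrite /full (transport_endpoint (e := e) (b := true)) //.
Qed.

Lemma transport_full_endpoint e b (j i : Q) (U : set (V j)) :
  side e b j -> side e (~~ b) i -> transport V U i `<=` full (endpoint e b) i.
Proof.
move=> sj si; rewrite (transport_split U sj si) /full (transport_endpoint (b := b)) //.
by apply: transport_mono; exact: transport_along_mono.
Qed.

Definition subgroup (M : lmodType K) (U : set M) :=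
  U 0 /\ forall x y, U x -> U y -> U (x - y).

Lemma subgroupD (M : lmodType K) (U : set M) x y :
  subgroup U -> U x -> U y -> U (x + y).
Proof.
move=> [U0 subU] Ux Uy; rewrite -(opprK y); apply: (subU) => //.
by rewrite -(add0r (- y)); exact: subU.
Qed.

Lemma subgroup_sum (M : lmodType K) (U : set M) n (v : 'I_n -> M) :
  subgroup U -> (forall k, U (v k)) -> U (\sum_(k < n) v k).
Proof.
move=> gU Uv; apply: big_ind => //; first by case: gU.
by move=> x y; exact: subgroupD.
Qed.

Lemma subgroup_transport (i j : Q) (U : set (V i)) :
  subgroup U -> subgroup (transport V U j).
Proof.
move=> gU; have [_ _ /(_ i j I I) [p _] _] := Qtree.
have [q [iq _ _]] := injective_route_of p.
rewrite (transportE _ iq); move: q {iq p} => p.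
elim: p => [|e p [IH0 IHB]|e p [IH0 IHB]] //=; split.
- by exists 0 => //; rewrite raddf0.
- by move=> _ _ [x px <-] [y py <-]; exists (x - y); [exact: IHB|rewrite raddfB].
- by rewrite /= raddf0.
- by move=> x y /= px py; rewrite raddfB; exact: IHB.
Qed.

Lemma subgroupT (M : lmodType K) : subgroup [set: M].
Proof. by []. Qed.

Lemma subgroup0 (M : lmodType K) : subgroup [set 0 : M].
Proof. by split=> // x y -> ->; rewrite subr0. Qed.

(** Transports to the two endpoints of [e] are the image or the preimage of each
other, depending on the side of [e] where the transported space starts. *)
Lemma transport_rmap e (j : Q) (U : set (V j)) x :
  transport V U (src e) x -> transport V U (tgt e) (rmap V e x).
Proof.
case: (side_cover Qtree e true j) => sj.
- by rewrite (transport_step (b := true) U sj).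
- by move=> Ux; rewrite (transport_step (b := false) U sj); exists x.
Qed.

End Transport.

Arguments full {K Q} V j i.

(** * Virtual arrows *)

Section Rays.
Context {Q : quiver} (Qtree : is_tree Q).
Implicit Types (e : arrow Q) (E : virtual_arrow Q).

Lemma no_opposite e e' : src e = tgt e' -> tgt e = src e' -> False.
Proof.
have [loop mult _ _] := Qtree.
move=> se te; have ee : e = e' by apply: (mult _ _ (src e) (tgt e)); [left|right].
by apply: (loop e); rewrite {2}ee.
Qed.

(** [D] is the set of indices, either all of [nat] or an initial segment. *)
Lemma ray_walk (u : nat -> Q) (D : nat -> Prop) :
  (forall m n, (m <= n)%N -> D n -> D m) ->
  (forall n, D n.+1 -> exists e, joins e (u n) (u n.+1)) ->
  exists w : walk Q, (forall z, dom w z <-> 0 <= z /\ D (absz z)) /\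
    (forall z, at_ w z = u (absz z)).
Proof.
move=> Ddown Dj.
have dconv (x y z : int) : (0 <= x /\ D (absz x)) -> (0 <= z /\ D (absz z)) ->
    x <= y <= z -> 0 <= y /\ D (absz y).
  move=> [x0 _] [z0 Dz] /andP[xy yz]; split; first exact: le_trans xy.
  by apply: Ddown Dz; lia.
have wj (z : int) : (0 <= z /\ D (absz z)) -> (0 <= z + 1 /\ D (absz (z + 1))) ->
    exists e, joins e (u (absz z)) (u (absz (z + 1))).
  move=> [z0 _] [_]; have -> : (absz (z + 1)) = (absz z).+1 by lia.
  exact: Dj.
by exists (@Walk Q [set z | 0 <= z /\ D (absz z)] (fun z => u (absz z)) dconv wj).
Qed.

Lemma infinite_nonneg (A : set int) : (forall n : nat, A n%:Z) -> infinite_set A.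
Proof.
move=> An finA; apply: infinite_nat.
apply: (sub_finite_set _ (finite_image absz finA)) => n _.
by exists n%:Z.
Qed.

(** All virtual arrows below are obtained from this one construction. *)
Lemma ray_virtual (u : nat -> Q) (D : nat -> Prop) :
  D 0%N -> (forall m n, (m <= n)%N -> D n -> D m) ->
  (forall n, D n.+1 -> exists e, src e = u n /\ tgt e = u n.+1) ->
  (forall m n, D m -> D n -> u m = u n -> m = n) ->
  (forall n, D n) \/ (exists m, [/\ D m, forall n, D n -> (n <= m)%N & leaf (u m)]) ->
  exists E, (forall z, dom E z <-> 0 <= z /\ D (absz z)) /\
    (forall z, at_ E z = u (absz z)).
Proof.
move=> D0 Ddown Da Dinj Dend.
have [|w [wd wa]] := ray_walk Ddown (u := u).
  by move=> n /Da[e]; exists e; left.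
have injw : injective_walk w.
  move=> x y /wd[x0 Dx] /wd[y0 Dy]; rewrite !wa => /Dinj-/(_ Dx Dy); lia.
have jw : journey w.
  by exists 0; split=> [|z /wd[]//]; apply/wd.
have ow e : walk_arrows w e -> oriented_consistently w e.
  case=> // -[z [/wd[z0 Dz] /wd[z1]]]; rewrite !wa.
  have -> : (absz (z + 1)) = (absz z).+1 by lia.
  by move=> /Da[e' [se' te']] se te; case: (@no_opposite e e'); congruence.
have ew : infinite_set (dom w) \/
    exists m, [/\ dom w m, forall z, dom w z -> z <= m & leaf (at_ w m)].
  case: Dend => [DT|[m [Dm mmax lm]]]; [left|right].
    by apply: infinite_nonneg => n; apply/wd.
  exists m%:Z; split; [exact/wd| |by rewrite wa].
  by move=> z /wd[z0 /mmax]; lia.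
by exists (VirtualArrow injw jw ow ew).
Qed.

(** The orientation condition of a virtual arrow speaks of arrows, not of indices;
injectivity shows that an arrow between two consecutive vertices occurs only
there. *)
Lemma va_arrow E z : dom E z -> dom E (z + 1) ->
  exists e, src e = at_ E z /\ tgt e = at_ E (z + 1).
Proof.
move=> dz dz1; have [e J] := walk_joins dz dz1.
have /va_outward[y [dy dy1 sy ty]] : walk_arrows E e.
  by case: J => -[? ?]; [left|right]; exists z.
case: J => -[se te]; first by exists e.
have yz : y = z + 1 by apply: (va_injective dy dz1); rewrite -sy.
have : y + 1 = z by apply: (va_injective dy1 dz); rewrite -ty.
by rewrite yz; lia.
Qed.

Lemma va_ind E (P : set Q) z z' :
  (forall h, walk_vertices E (src h) -> walk_vertices E (tgt h) ->
     P (src h) -> P (tgt h)) ->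
  dom E z -> dom E z' -> z <= z' -> P (at_ E z) -> P (at_ E z').
Proof.
move=> step dz dz' zz'; have -> : z' = z + (absz (z' - z))%:Z by lia.
have : dom E (z + (absz (z' - z))%:Z) by have <- : z' = z + (absz (z' - z))%:Z by lia.
elim: (absz (z' - z)) => [|n IH] dn Pz; first by rewrite addr0.
have dn' : dom E (z + n%:Z) by apply: (dom_convex dz dn); lia.
have nE : z + n.+1%:Z = z + n%:Z + 1 by lia.
rewrite nE in dn *; have [h [sh th]] := va_arrow dn' dn.
rewrite -th; apply: step.
- by exists (z + n%:Z).
- by exists (z + n%:Z + 1).
- by rewrite sh; exact: IH.
Qed.

Lemma va_start E : exists z, dom E z.
Proof. by have [m [dm _]] := va_journey E; exists m. Qed.

(** A virtual arrow can cross [e] only along its direction, so it never comes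
back from the front. *)
Lemma va_front E e z z' : dom E z -> dom E z' -> z <= z' ->
  front e (at_ E z) -> front e (at_ E z').
Proof.
apply: va_ind => h _ _; have [->|ne] := pselect (h = e).
  by move=> _; exact: (side_endpoint e true).
exact: (side_cross (b := true) (c := false)).
Qed.

(** Unlike containment of all the vertices, this is invariant under passing to end
segments. *)
Definition eventually_in E (S : set Q) :=
  exists m, dom E m /\ forall z, dom E z -> m <= z -> S (at_ E z).

Lemma eventually_in_meet E S S' :
  eventually_in E S -> eventually_in E S' -> exists v, S v /\ S' v.
Proof.
move=> [m [dm Sm]] [m' [dm' Sm']]; case: (leP m m') => mm.
- by exists (at_ E m'); split; [exact: Sm|exact: Sm'].
- by exists (at_ E m); split; [exact: Sm|apply: Sm' => //; exact: ltW].
Qed.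

Lemma eventually_in_sub E (S : set Q) : walk_vertices E `<=` S -> eventually_in E S.
Proof.
move=> ES; have [m dm] := va_start E; exists m; split=> // z dz _.
by apply: ES; exists z.
Qed.

Lemma va_side E e : eventually_in E (front e) \/ walk_vertices E `<=` behind e.
Proof.
have [[z [dz fz]]|nE] := pselect (exists z, dom E z /\ front e (at_ E z)).
  by left; exists z; split=> // z' dz' zz'; exact: va_front fz.
right=> _ [z dz <-]; apply: (@sideN _ Qtree e true) => fz; apply: nE.
by exists z.
Qed.

Lemma eventually_behind E e : eventually_in E (behind e) -> walk_vertices E `<=` behind e.
Proof.
move=> Eb; case: (va_side E e) => // Ef.
by have [v [fv bv]] := eventually_in_meet Ef Eb; case: (front_behind Qtree fv bv).
Qed.

Lemma behind_virtual_behind E e : walk_vertices E `<=` behind e -> virtual_behind e E.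
Proof.
move=> Eb; exists E; split=> //; have [m [dm mmin]] := va_journey E.
exists 0, m; split=> z; rewrite addr0 //.
by split=> [dz|[]//]; split=> //; exact: mmin.
Qed.

(** A bounded convex set of integers is finite, so an infinite virtual arrow has
no last vertex. *)
Lemma va_infinite E z : infinite_set (dom E) -> dom E z -> forall n : nat, dom E (z + n%:Z).
Proof.
move=> infE dz n; apply: contrapT => nd; apply: infE.
have [m [dm mmin]] := va_journey E.
have fI := finite_image (fun k : nat => m + k%:Z) (finite_II (absz (z + n%:Z - m)%R)).
apply: (sub_finite_set _ fI) => y dy.
have ym : m <= y by exact: mmin.
have yn : y < z + n%:Z.
  rewrite ltNge; apply/negP => ny; apply: nd; apply: (dom_convex dz dy).
  by apply/andP; split=> //; lia.
by exists (absz (y - m)); rewrite /= /mkset; lia.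
Qed.

Lemma va_tail E z : dom E z -> exists E', forall y, dom E' y ->
  exists y', [/\ dom E y', z <= y' & at_ E' y = at_ E y'].
Proof.
move=> dz.
have [|||||E' [E'd E'a]] := @ray_virtual (fun n => at_ E (z + n%:Z)) (fun n => dom E (z + n%:Z)).
- by rewrite addr0.
- by move=> m n mn dn; apply: (dom_convex dz dn); lia.
- move=> n dn; have nE : z + n.+1%:Z = z + n%:Z + 1 by lia.
  rewrite nE in dn *; apply: va_arrow => //.
  by apply: (dom_convex dz dn); lia.
- by move=> m n dm dn /(va_injective dm dn); lia.
- have [infE|[m [dm mmax lm]]] := va_end E; [left|right].
    exact: va_infinite.
  have zm := mmax _ dz; have mE : z + (absz (m - z))%:Z = m by lia.
  exists (absz (m - z)); rewrite mE; split=> // n /mmax; lia.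
exists E' => y /E'd[y0 dy]; exists (z + (absz y)%:Z).
by split=> //; lia.
Qed.

End Rays.

Section SideVirtual.
Context {Q : quiver} (Qtree : is_tree Q) (Qoutward : eventually_outward Q).
Implicit Types (e : arrow Q) (E : virtual_arrow Q).

Lemma finite_nat_bound (A : set nat) : finite_set A ->
  exists N, forall n, (N <= n)%N -> ~ A n.
Proof.
move=> /finite_seqP[s ->]; exists (\max_(x <- s) x).+1 => n sn /= ns.
by have := leq_trans sn (@leq_bigmax_seq _ s xpredT id n ns isT); rewrite ltnn.
Qed.

Lemma not_leaf_next e b : ~ leaf (endpoint e b) ->
  exists h c, h <> e /\ endpoint h (~~ c) = endpoint e b.
Proof.
move=> nl; apply: contrapT => nh; apply: nl; exists e; split.
  by case: b {nh}; [right|left].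
move=> h inc; apply: contrapT => ne; apply: nh.
by case: inc => inc; [exists h, true|exists h, false]; split=> // /esym.
Qed.

(** Walking away from [e] into a side without leaves never stops, and the sides
ahead of the successive arrows are nested, so the walk is injective.  Only
finitely many of its arrows point backwards, and what follows the last of these
is a virtual arrow. *)
Lemma side_virtual e b : exists E, walk_vertices E `<=` side e b.
Proof.
have [[v [sv lv]]|nl] := pselect (exists v, side e b v /\ leaf v).
  have [||||| E [Ed Ea]] := @ray_virtual _ Qtree (fun=> v) (fun n => n = 0%N) => //.
  - by move=> m n mn n0; move: mn; rewrite n0; lia.
  - by move=> m n -> ->.
  - by right; exists 0%N; split=> // n ->.
  by exists E => _ [z _ <-]; rewrite Ea.
have /choice[f fP] : forall s : arrow Q * bool, exists t : arrow Q * bool,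
    side s.1 s.2 `<=` side e b ->
    t.1 <> s.1 /\ endpoint t.1 (~~ t.2) = endpoint s.1 s.2.
  move=> [h c] /=.
  have [sub|] := pselect (side h c `<=` side e b); last by exists (h, c).
  have [|h' [c' hc]] := @not_leaf_next h c; last by exists (h', c').
  by move=> lh; apply: nl; exists (endpoint h c); split=> //; apply: sub; exact: side_endpoint.
(* A state is an arrow with the direction in which it has just been crossed. *)
pose st n := iter n f (e, b); pose a n := (st n).1; pose c n := (st n).2.
pose u n := endpoint (a n) (c n).
have next n : side (a n) (c n) `<=` side e b ->
    [/\ a n.+1 <> a n, endpoint (a n.+1) (~~ c n.+1) = u n
      & side (a n.+1) (c n.+1) `<=` side (a n) (c n)].
  by move=> /fP[ne E]; split=> //; exact: side_next.
have inside n : side (a n) (c n) `<=` side e b.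
  elim: n => [//|n IH]; have [_ _ sub] := next n IH.
  exact: subset_trans sub IH.
have nested m n : (m <= n)%N -> side (a n) (c n) `<=` side (a m) (c m).
  move=> mn; rewrite -(subnK mn); elim: (n - m)%N => [//|k IH].
  by have [_ _ sub] := next _ (inside (k + m)%N); exact: subset_trans sub IH.
have ulast n : endpoint (a n.+1) (~~ c n.+1) = u n by case: (next n (inside n)).
have ult m n : (m < n)%N -> u m <> u n.
  move=> mn mun; apply: (endpoint_notin Qtree (e := a m.+1) (b := ~~ c m.+1)).
  rewrite negbK ulast mun; apply: (nested _ _ mn); exact: side_endpoint.
have uinj m n : u m = u n -> m = n.
  by move=> mun; case: (ltngtP m n) => // /ult; rewrite mun.
have uarrow n : if c n.+1 then src (a n.+1) = u n /\ tgt (a n.+1) = u n.+1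
                else src (a n.+1) = u n.+1 /\ tgt (a n.+1) = u n.
  by have := ulast n; rewrite /u; case: (c n.+1).
have ainj m n : a m.+1 = a n.+1 -> m = n.
  have lt k l : (k < l)%N -> a k.+1 <> a l.+1.
    move=> kl akl; have := uarrow k; have := uarrow l; rewrite -akl.
    have kl1 := ult _ _ kl; have kl2 : u k <> u l.+1 by apply: ult; lia.
    by do 2 case: (c _); move=> [? ?] [? ?]; congruence.
  by move=> amn; case: (ltngtP m n) => // /lt; rewrite amn.
(* An arrow can thus be crossed backwards only once, and finitely many are. *)
have [w [wd wa]] : exists w : walk Q, (forall z, dom w z <-> 0 <= z /\ True) /\
    (forall z, at_ w z = u (absz z)).
  apply: (@ray_walk _ u (fun=> True)) => // n _; exists (a n.+1).
  by have := uarrow n; case: (c n.+1) => ?; [left|right].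
have injw : injective_walk w.
  by move=> x y /wd[x0 _] /wd[y0 _]; rewrite !wa => /uinj; lia.
have jw : journey w by exists 0; split=> [|z /wd[]//]; apply/wd.
have finw := Qoutward injw jw.
have [N Nout] : exists N, forall n, (N <= n)%N -> c n.+1.
  have [|N NA] := @finite_nat_bound [set n | oriented_inconsistently w (a n.+1)].
    by apply: finite_preimage finw => m n _ _ /ainj.
  exists N => n /NA nA; apply: contrapT => /negP cn; apply: nA => /=.
  have := uarrow n; rewrite (negbTE cn) => -[sa ta].
  exists n%:Z; rewrite !wa; split; [exact/wd|exact/wd| |by rewrite ta].
  by rewrite sa; congr u; lia.
have [||||| E [Ed Ea]] := @ray_virtual _ Qtree (fun n => u (N + n)%N) (fun=> True) => //.
- move=> n _; exists (a (N + n).+1); have := uarrow (N + n)%N.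
  by rewrite Nout ?leq_addr // addnS.
- by move=> m n _ _ /uinj; lia.
- by left.
exists E => _ [z _ <-]; rewrite Ea; apply: (inside (N + absz z)%N).
exact: side_endpoint.
Qed.

End SideVirtual.

Section Vvirtual.
Context {K : fieldType} {Q : quiver} (Qtree : is_tree Q) (V : representation K Q).
Implicit Types (e : arrow Q) (E : virtual_arrow Q).

Lemma full_va E i z z' : dom E z -> dom E z' -> z <= z' ->
  full V (at_ E z) i `<=` full V (at_ E z') i.
Proof.
move=> dz dz' zz' x.
apply: (@va_ind _ E (fun v => full V v i x)) dz dz' zz' => h _ _.
exact: full_arrow.
Qed.

(** A route from [src h] to the front of [h] passes through [tgt h]. *)
Lemma route_shorten h (k i : Q) (p : route k i) : k = src h -> front h i ->
  exists p' : route (tgt h) i, (route_length p' < route_length p)%N.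
Proof.
move=> kh; elim: p => [|e p IH|e p IH] /= si.
- case: (@endpoint_notin _ Qtree h false); by rewrite /endpoint -kh.
- case: (side_cover Qtree h true (src e)) => [/IH[p' lp']|be].
    by exists (fwd p').
  have [<-|ne] := pselect (e = h); first by exists (stay (tgt e)).
  by case: (front_behind Qtree si (side_cross (b := false) (c := false) ne be)).
- case: (side_cover Qtree h true (tgt e)) => [/IH[p' lp']|be].
    by exists (bwd p').
  have [eh|ne] := pselect (e = h).
    by case: (@endpoint_notin _ Qtree h false); rewrite -{2}eh.
  by case: (front_behind Qtree si (side_cross (b := false) (c := true) ne be)).
Qed.

(** Otherwise the next vertex would be closer to [i]. *)
Lemma closest_behind E i z h : closest E i (at_ E z) -> dom E z -> dom E (z + 1) ->
  src h = at_ E z -> tgt h = at_ E (z + 1) -> behind h i.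
Proof.
move=> [_ [p pmin]] dz dz1 sh th; apply: (@sideN _ Qtree h true) => fi.
have [p' lp'] := route_shorten p (esym sh) fi.
have Et : walk_vertices E (tgt h) by exists (z + 1).
by have := pmin _ Et p'; lia.
Qed.

(** The parts behind the successive arrows of a virtual arrow are nested. *)
Lemma closest_behind_all E i z (n : nat) h : closest E i (at_ E z) -> dom E z ->
  dom E (z + n%:Z) -> dom E (z + n%:Z + 1) ->
  src h = at_ E (z + n%:Z) -> tgt h = at_ E (z + n%:Z + 1) -> behind h i.
Proof.
move=> cz dz; elim: n h => [|n IH] h; first by rewrite addr0; exact: closest_behind.
have nE : z + n.+1%:Z = z + n%:Z + 1 by lia.
rewrite nE => dn1 dn2 sh th.
have dn : dom E (z + n%:Z) by apply: (dom_convex dz dn1); lia.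
have [h' [sh' th']] := va_arrow dn dn1.
have := IH _ dn dn1 sh' th'.
apply: (@side_next _ Qtree h false h' false) => [hh|]; last by rewrite /= sh.
by apply: (@src_neq_tgt _ Qtree h); rewrite -{2}hh sh.
Qed.

(** The full space at the vertices of a virtual arrow has transports to [i] that
grow along the arrow, and are constant from the vertex closest to [i] on.  This
form avoids closest vertices and depends only on the end segments of [E]. *)
Lemma VvirtualE E i x :
  Vvirtual V E i x <-> exists z, dom E z /\ full V (at_ E z) i x.
Proof.
rewrite /Vvirtual; case: asboolP => [[z dz zi]|nEi]; split => //=.
- by move=> _; exists z; split=> //; rewrite zi; exact: full_id.
- by move=> [j [[[z dz <-] _] xj]]; exists z.
move=> [z [dz xz]].
have [z0 [dz0 cz0]] : exists z0, dom E z0 /\ closest E i (at_ E z0).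
  pose P n := `[< exists j, walk_vertices E j /\ exists p : route j i, route_length p = n >].
  have [_ _ /(_ (at_ E z) i I I) [p _] _] := Qtree.
  have exP : exists n, P n.
    by exists (route_length p); apply/asboolP; exists (at_ E z); split; [exists z|exists p].
  case: (ex_minnP exP) => n /asboolP[_ [[z0 dz0 <-] [q lq]]] nmin.
  exists z0; split=> //; split; first by exists z0.
  exists q => j' Ej' p'; rewrite lq; apply: nmin; apply/asboolP.
  by exists j'; split=> //; exists p'.
exists (at_ E z0); split=> //.
case: (leP z z0) => zz0; first exact: (full_va dz dz0 zz0 xz).
move: xz dz; have -> : z = z0 + (absz (z - z0))%:Z by lia.
elim: (absz (z - z0)) => [|n IH]; first by rewrite addr0.
have nE : z0 + n.+1%:Z = z0 + n%:Z + 1 by lia.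
rewrite nE => xn dn1.
have dn : dom E (z0 + n%:Z) by apply: (dom_convex dz0 dn1); lia.
have [h [sh th]] := va_arrow dn dn1.
apply: (IH _ dn); rewrite -sh; apply: (full_behind Qtree); last by rewrite th.
exact: (closest_behind_all cz0 dz0 dn dn1 sh th).
Qed.

Lemma full_Vvirtual E i z x : dom E z -> full V (at_ E z) i x -> Vvirtual V E i x.
Proof. by move=> dz xz; apply/VvirtualE; exists z. Qed.

Lemma end_segment_meet E E' k m (z : int) :
  (forall z, dom E' z <-> m <= z /\ dom E (z + k)) -> dom E z ->
  exists z', [/\ dom E' z', z <= z' + k & dom E (z' + k)].
Proof.
move=> Ed dz; have [y dy] := va_start E'.
have [my dyk] := (Ed y).1 dy.
case: (leP z (y + k)) => zy; first by exists y.
exists (z - k); have kE : z - k + k = z by lia.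
by rewrite kE; split=> //; apply/Ed; rewrite kE; split=> //; lia.
Qed.

Lemma end_segment_Vvirtual E E' i : end_segment E' E -> Vvirtual V E' i = Vvirtual V E i.
Proof.
move=> [k [m [Ed Ea]]]; apply/seteqP; split=> x /VvirtualE[z [dz xz]].
  apply: (@full_Vvirtual E i (z + k)); first by case: ((Ed z).1 dz).
  by rewrite -Ea.
have [z' [dz' zz' dzk]] := end_segment_meet Ed dz.
apply: (full_Vvirtual dz'); rewrite Ea //; exact: (full_va dz dzk zz').
Qed.

Lemma same_Vvirtual E E' i : same_virtual_arrow E E' -> Vvirtual V E i = Vvirtual V E' i.
Proof.
elim=> {E E'} [E E'|//|E E' _ ->//|E E' E'' _ -> _ ->//].
exact: end_segment_Vvirtual.
Qed.

Lemma end_segment_eventually E E' S : end_segment E' E ->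
  eventually_in E' S <-> eventually_in E S.
Proof.
move=> [k [m [Ed Ea]]]; split=> -[z [dz Sz]].
  have [mz dzk] := (Ed z).1 dz; exists (z + k); split=> // y dy zy.
  have kE : y - k + k = y by lia.
  have dy' : dom E' (y - k) by apply/Ed; rewrite kE; split=> //; lia.
  by rewrite -kE -Ea //; apply: Sz => //; lia.
have [z' [dz' zz' dzk]] := end_segment_meet Ed dz.
exists z'; split=> // y dy zy; have [my dyk] := (Ed y).1 dy.
by rewrite Ea //; apply: Sz => //; lia.
Qed.

Lemma same_eventually E E' S : same_virtual_arrow E E' ->
  eventually_in E S <-> eventually_in E' S.
Proof.
elim=> {E E'} [E E'|//|E E' _ ->//|E E' E'' _ -> _ ->//].
exact: end_segment_eventually.
Qed.

Lemma subgroup_Vvirtual E i : subgroup (Vvirtual V E i).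
Proof.
split; first by have [z dz] := va_start E; apply: (full_Vvirtual dz);
  by case: (subgroup_transport Qtree i (subgroupT (V (at_ E z)))).
move=> x y /VvirtualE[z [dz xz]] /VvirtualE[z' [dz' yz']].
wlog zz' : x y z z' dz dz' xz yz' / z <= z' => [wl|].
  case: (leP z z') => zz'; first exact: (wl _ _ _ _ dz dz').
  apply: (full_Vvirtual dz).
  have [_ sub] := subgroup_transport Qtree i (subgroupT (V (at_ E z))).
  by apply: sub => //; apply: (full_va dz' dz (ltW zz')).
apply: (full_Vvirtual dz').
have [_ sub] := subgroup_transport Qtree i (subgroupT (V (at_ E z'))).
by apply: sub => //; apply: (full_va dz dz' zz').
Qed.

End Vvirtual.

(** * Ends of a connected subquiver *)

Lemma neq_negb (b d : bool) : d <> b -> d = ~~ b.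
Proof. by case: b d => -[]. Qed.

Section Ends.
Context {K : fieldType} {Q : quiver} (Qtree : is_tree Q) (Qoutward : eventually_outward Q).
Context (V : representation K Q).
Implicit Types (e g h : arrow Q) (E : virtual_arrow Q) (A B : csub Q).

(** [ArrowEnd g d] is the arrow [g] seen as a boundary arrow of a subquiver
that lies on the side opposite to [side g d]: incoming for [d = false], outgoing
for [d = true]. *)
Inductive tree_end := ArrowEnd (g : arrow Q) (d : bool) | VirtualEnd (E : virtual_arrow Q).

Implicit Type c : tree_end.

Definition is_end (A : set Q) c : Prop :=
  match c with
  | ArrowEnd g d => A (endpoint g (~~ d)) /\ ~ A (endpoint g d)
  | VirtualEnd E => virtual_boundary_arrow A E
  end.

Definition cond c (i : Q) : set (V i) :=
  match c with
  | ArrowEnd g d => if d then Vminus V g i else Vplus V g i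
  | VirtualEnd E => Vvirtual V E i
  end.

Arguments cond : clear implicits.

Definition on_side e b c : Prop :=
  match c with
  | ArrowEnd g d => g <> e /\ side g d `<=` side e b
  | VirtualEnd E => eventually_in E (side e b)
  end.

Lemma end_near A g d : is_end A (ArrowEnd g d) -> A `<=` side g (~~ d).
Proof.
move=> [An Af]; apply: (connected_side (@csub_connected _ A)) An (side_endpoint _ _).
by move=> /arrow_in_endpoint/(_ d).
Qed.

Lemma ibaP A g : iba A g <-> is_end A (ArrowEnd g false).
Proof.
split=> [[[[As At]|[As At]] Af]|[At As]].
- by case: (@endpoint_notin _ Qtree g false); exact: Af.
- by split.
- by split; [right|exact: (@end_near A g false)].
Qed.

Lemma obaP A g : oba A g <-> is_end A (ArrowEnd g true).
Proof.
split=> [[[[As At]|[As At]] Af]|[As At]].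
- by split.
- by case: (@endpoint_notin _ Qtree g true); exact: Af.
- by split; [left|exact: (@end_near A g true)].
Qed.

Lemma F_cond A i x : F V A i x <-> forall c, is_end A c -> cond c i x.
Proof.
split=> [[Fi Fo Fv] [g []|E]|Fc]; first by move/obaP/Fo.
- by move/ibaP/Fi.
- by move/Fv.
split.
- by move=> e /ibaP/Fc.
- by move=> e /obaP/Fc.
- by move=> E EA; exact: (Fc (VirtualEnd E)).
Qed.

(** The subspace of [V (tgt g)] whose transports are the conditions of
[ArrowEnd g d]; on the side beyond [g] the condition is of the same form. *)
Definition base (d : bool) (M : lmodType K) : set M := if d then [set 0] else setT.
Arguments base d M : clear implicits.

Lemma subgroup_base d M : subgroup (base d M).
Proof. by case: d; [exact: subgroup0|exact: subgroupT]. Qed.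

Lemma cond_beyond g d i : side g d i -> cond (ArrowEnd g d) i = base d (V i).
Proof. by case: d => /= s; rewrite /Vminus /Vplus asboolT. Qed.

Lemma cond_near g d i : ~ side g d i ->
  cond (ArrowEnd g d) i = transport V (base d (V (tgt g))) i.
Proof. by case: d => /= s; rewrite /Vminus /Vplus asboolF. Qed.

Lemma subgroup_cond c i : subgroup (cond c i).
Proof.
case: c => [g d|E]; last exact: subgroup_Vvirtual.
have [s|s] := pselect (side g d i); first by rewrite cond_beyond //; exact: subgroup_base.
rewrite cond_near //; apply: subgroup_transport => //; exact: subgroup_base.
Qed.

Lemma cond_rmap c e x : cond c (src e) x -> cond c (tgt e) (rmap V e x).
Proof.
case: c => [g d|E]; last first.
  move=> /(VvirtualE Qtree)[z [dz xz]]; apply: (full_Vvirtual Qtree dz).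
  exact: transport_rmap.
have [eg|ne] := pselect (e = g).
  subst g; case: d.
    rewrite (cond_beyond (side_endpoint e true)) (cond_near (@endpoint_notin _ Qtree e false)).
    by rewrite (@transport_step _ _ Qtree V e true) ?transport_id //; exact: (side_endpoint e true).
  by rewrite (cond_near (@endpoint_notin _ Qtree e true)) /= transport_id.
have [s|s] := pselect (side g d (src e)).
  rewrite !cond_beyond //; last exact: (side_cross (c := false) ne s).
  by case: d {s} => //= ->; rewrite raddf0.
rewrite !cond_near //; first exact: transport_rmap.
by move=> s'; apply: s; exact: (side_cross (c := true) ne s').
Qed.

Lemma on_side_endpoint e b g d d' : on_side e b (ArrowEnd g d) -> side e b (endpoint g d').
Proof.
move=> [ne sub]; have s : side e b (endpoint g d) by apply: sub; exact: side_endpoint.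
case: (d' =P d) => [->//|/neq_negb ->]; exact: side_cross.
Qed.

Lemma full_eventually E (S : set Q) i x : eventually_in E S -> Vvirtual V E i x ->
  exists z, [/\ dom E z, S (at_ E z) & full V (at_ E z) i x].
Proof.
move=> [m [dm Sm]] /(VvirtualE Qtree)[z [dz xz]]; case: (leP m z) => mz.
- by exists z; split=> //; exact: Sm.
- exists m; split=> //; first exact: Sm.
  exact: (full_va Qtree dz dm (ltW mz) xz).
Qed.

(** Transports that start on one side of [e] reach the other endpoint through
[e]. *)
Lemma on_side_step e b c : on_side e b c ->
  cond c (endpoint e (~~ b)) = cross (cond c (endpoint e b)).
Proof.
case: c => [g d|E] ce.
  have [ne sub] := ce.
  rewrite !cond_near.
  - apply: transport_step => //; exact: (@on_side_endpoint _ _ _ _ true ce).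
  - move=> s; have := side_cross (not_eq_sym ne) s.
    by move=> /sub; exact: endpointN_notin.
  - by move=> /sub; exact: endpointN_notin.
apply/seteqP; split=> y.
  move=> /(full_eventually ce)[z [dz sz]]; rewrite /full transport_step //.
  by apply: transport_along_mono => x; exact: (full_Vvirtual Qtree dz).
have back z x : dom E z -> side e b (at_ E z) ->
    cross (full V (at_ E z) (endpoint e b)) x -> cond (VirtualEnd E) (endpoint e (~~ b)) x.
  move=> dz sz; rewrite /full -transport_step // => yz.
  exact: (full_Vvirtual Qtree dz).
case: b ce back y => ce back y /=.
  move=> yE; have [z [dz sz xz]] := full_eventually ce yE.
  exact: back dz sz _.
move=> [x xE xy]; have [z [dz sz xz]] := full_eventually ce xE.
by apply: (back z _ dz sz); exists x.
Qed.

Lemma on_side_transport e b c i x : on_side e b c -> side e (~~ b) i -> cond c i x ->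
  full V (endpoint e b) i x.
Proof.
move=> ce si; case: c ce => [g d|E] ce.
  rewrite cond_near; last by case: ce => _ sub /sub se; exact: (side_disj Qtree se si).
  apply: transport_full_endpoint => //; exact: (@on_side_endpoint _ _ _ _ true ce).
move=> /(full_eventually ce)[z [dz sz]].
exact: transport_full_endpoint.
Qed.

Lemma on_side_zero e b c i x : on_side e b c -> side e (~~ b) i ->
  transport V [set (0 : V (endpoint e b))] i x -> cond c i x.
Proof.
move=> ce si.
have zero j (U : set (V j)) : side e b j -> subgroup U ->
    transport V [set (0 : V (endpoint e b))] i `<=` transport V U i.
  move=> sj gU; rewrite (transport_split Qtree U sj si) (transport_endpoint Qtree (b := b)) //.
  apply: transport_mono; apply: transport_along_mono => _ ->.
  by case: (subgroup_transport Qtree (endpoint e b) gU).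
case: c ce => [g d|E] ce.
  rewrite cond_near; last by case: ce => _ sub /sub se; exact: (side_disj Qtree se si).
  apply: zero; [exact: (@on_side_endpoint _ _ _ _ true ce)|exact: subgroup_base].
have [m [dm Sm]] := ce; move=> /(zero _ _ (Sm m dm (lexx m)) (subgroupT _)).
exact: (full_Vvirtual Qtree dm).
Qed.

(** The part beyond a boundary arrow of [A] is connected and does not contain [e],
and a virtual arrow that enters the front of [e] stays there. *)
Lemma end_side A e b c : arrow_in A e -> is_end A c -> on_side e b c \/ on_side e (~~ b) c.
Proof.
move=> Ae; case: c => [g d|E] cA; last first.
  case: (va_side Qtree E e) => [fE|/eventually_in_sub bE]; case: b; by [left|right].
have ne : g <> e.
  by move=> ge; case: cA => _; apply; rewrite ge; move/arrow_in_endpoint: Ae; apply.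
have nA : ~ arrow_in (side g d) e.
  by move=> [sd _]; apply: (side_disj Qtree sd); apply: (end_near cA); case: Ae.
have sub b' := connected_side (@side_connected _ g d) nA (side_endpoint g d) (b := b').
by case: (side_cover Qtree e b (endpoint g d)) => /sub; [left|right].
Qed.

Lemma separating_arrow A (i : Q) : ~ csub_set A i ->
  exists g d, is_end A (ArrowEnd g d) /\ side g d i.
Proof.
have [a Aa] := @csub_nonempty _ A; have [_ _ /(_ a i I I) [p _] _] := Qtree.
pose reached v := csub_set A v \/ exists g d, is_end A (ArrowEnd g d) /\ side g d v.
have step h b : reached (endpoint h b) -> reached (endpoint h (~~ b)).
  have [An|nAn] := pselect (csub_set A (endpoint h (~~ b))); first by left.
  case=> [Ab|[g [d [cA sb]]]]; right.
    by exists h, (~~ b); split; [split; rewrite ?negbK|exact: side_endpoint].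
  exists g, d; split=> //; have [hg|ne] := pselect (h = g); last exact: side_cross.
  case: (d =P ~~ b) => [->|/neq_negb db]; first by rewrite hg; exact: side_endpoint.
  by case: cA => Agd _; case: nAn; rewrite hg; move: Agd; rewrite db negbK.
suff : reached i by case.
elim: p => [|e p IH|e p IH]; first by left.
- exact: (step e false).
- exact: (step e true).
Qed.

(** If [A] does not contain the whole side, then it has a boundary arrow there, and
if it does, then it contains the virtual arrow of side_virtual. *)
Lemma exists_end A e b : csub_set A (endpoint e b) -> exists c, is_end A c /\ on_side e b c.
Proof.
move=> Ab; have [sub|/existsNP[v /not_implyP[sv nAv]]] := pselect (side e b `<=` A).
  have [E ES] := @side_virtual _ Qtree Qoutward e b.
  exists (VirtualEnd E); split; first exact: subset_trans sub.
  exact: eventually_in_sub.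
have [g [d [cA sgv]]] := separating_arrow nAv.
exists (ArrowEnd g d); split=> //; split.
  move=> ge; case: cA => _; apply; rewrite ge.
  case: (d =P b) => [->//|/neq_negb db]; case: (side_disj Qtree sv).
  by rewrite -ge -db.
apply: (connected_side _ _ sgv sv); first exact: side_connected.
move=> /arrow_in_endpoint/(_ b) sd; apply: (side_disj Qtree sd); exact: (end_near cA).
Qed.

Lemma subgroup_F A i : subgroup (F V A i).
Proof.
split=> [|x y /F_cond xF /F_cond yF]; apply/F_cond => c cA.
- by case: (subgroup_cond c i).
- by case: (subgroup_cond c i) => _; apply; [exact: xF|exact: yF].
Qed.

Lemma F_rmap A e x : F V A (src e) x -> F V A (tgt e) (rmap V e x).
Proof. by move=> /F_cond xF; apply/F_cond => c /xF; exact: cond_rmap. Qed.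

Lemma F_outside A g i x : is_end A (ArrowEnd g true) -> front g i -> F V A i x -> x = 0.
Proof. by move=> cA fi /F_cond/(_ _ cA); rewrite (@cond_beyond g true i fi). Qed.

(** An arrow that leaves the cut part but not [A] has endpoints on both sides of
[e]. *)
Lemma end_cut A B e b c : (B : set Q) = A `&` side e b -> is_end B c ->
  is_end A c \/ c = ArrowEnd e (~~ b).
Proof.
move=> BA; case: c => [g d|E]; last by move=> EB; left => v /EB; rewrite BA => -[].
rewrite /is_end BA => -[[An sn] nf].
have [Af|nAf] := pselect (csub_set A (endpoint g d)); last by left.
right; have nsf : ~ side e b (endpoint g d) by move=> sf; exact: nf.
have [ge|ne] := pselect (g = e); last first.
  by case: nsf; rewrite -(negbK d); exact: side_cross.
rewrite ge; congr (ArrowEnd e _).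
case: (d =P ~~ b) => // /neq_negb; rewrite negbK => db; case: nsf; rewrite ge db.
exact: side_endpoint.
Qed.

(** The reduction has [e] as an outgoing end.  This makes [F] vanish in front of
[e]; behind [e] its condition is the transport of zero through [e], which lies in
the condition of every end of [A] in front of [e]. *)
Lemma F_reduction B A i : reduction B A -> F V B i `<=` F V A i.
Proof.
move=> [e [Ae BA]] x xF.
have cB : is_end B (ArrowEnd e true).
  rewrite /is_end BA; split; first by split; [case: Ae|exact: (side_endpoint e false)].
  by move=> [_]; exact: (@endpoint_notin _ Qtree e true).
case: (side_cover Qtree e true i) => si.
  by rewrite (F_outside cB si xF); case: (subgroup_F A i).
move/F_cond: xF => xF; apply/F_cond => c cA.
case: (end_side true Ae cA) => ce.
  apply: (on_side_zero ce si); have := xF _ cB.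
  by rewrite (@cond_near e true) // => si'; exact: (side_disj Qtree si' si).
apply: xF; case: c cA ce => [g d|E] cA ce.
  have sg d' : behind e (endpoint g d') by exact: on_side_endpoint ce.
  by rewrite /is_end BA; case: cA => An Af; split; [split|move=> [/Af]].
rewrite /is_end BA => v Ev; split; first exact: cA.
exact: (eventually_behind Qtree ce).
Qed.

(** The only end of [B] that [A] has lost is [e].  Its condition follows from that
of any end of [A] behind [e], and there is one. *)
Lemma F_enhancement A B i : enhancement A B -> F V A i `<=` F V B i.
Proof.
move=> [e [Ae BA]] x xF; apply/F_cond => c cB.
case: (end_cut (b := true) BA cB) => [cA|->]; first by move/F_cond: xF; apply.
have [bi|nbi] := pselect (behind e i); first by rewrite cond_beyond.
rewrite cond_near //; apply: (full_arrow Qtree).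
have fi : front e i by exact: (@sideN _ Qtree e false).
have [c' [cA' ce']] := @exists_end A e false Ae.1.
by apply: (on_side_transport (b := false) ce') => //; move/F_cond: xF; apply.
Qed.

Lemma F_lt B A i : csub_lt B A -> F V B i `<=` F V A i.
Proof.
elim=> {B A} [B A|B A C _ BA _ CA]; last exact: subset_trans BA CA.
by case; [exact: F_reduction|exact: F_enhancement].
Qed.

(** Once an arrow [e] of [A] has been cut off by a reduction, later
enhancements cannot restore it, since they only prolong across incoming boundary
arrows; so an outgoing boundary arrow keeps pointing towards it. *)
Lemma lt_loses B A e : csub_lt B A -> arrow_in A e ->
  arrow_in B e \/ exists g, is_end B (ArrowEnd g true) /\ front g (tgt e).
Proof.
pose P (A : csub Q) := arrow_in A e \/ exists g, is_end A (ArrowEnd g true) /\ front g (tgt e).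
suff lt_P : forall B A, csub_lt B A -> P A -> P B by move=> /lt_P BA Ae; apply: BA; left.
move=> {}B {}A; elim=> {B A} [B A|B A C _ BA _ CA /CA/BA//].
case=> -[h [Ah BA]].
  have cB : is_end B (ArrowEnd h true).
    rewrite /is_end BA; split; first by split; [case: Ah|exact: (side_endpoint h false)].
    by move=> [_]; exact: (@endpoint_notin _ Qtree h true).
  case=> [Ae|[g [cA fg]]].
    have [he|ne] := pselect (h = e).
      by right; exists h; split=> //; rewrite -he; exact: (side_endpoint h true).
    have [[bs bt]|[fs ft]] := @arrow_side _ Qtree h false e (not_eq_sym ne).
      by left; rewrite /arrow_in BA; case: Ae.
    by right; exists h.
  have ne : g <> h by move=> gh; case: cA => _; apply; rewrite gh; case: Ah.
  case: (end_side false Ah cA) => -[_ sub].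
    right; exists g; split=> //.
    have bg d' : behind h (endpoint g d') by exact: (@on_side_endpoint h false g true).
    by rewrite /is_end BA; case: cA => An Af; split; [split; last exact: (bg false)|move=> [/Af]].
  by right; exists h; split=> //; exact: sub.
case=> [Ae|[g [cA fg]]]; first by left; move: Ae; rewrite BA => -[[? _] [? _]].
by case: (end_cut (b := true) BA cA) => // cB; right; exists g.
Qed.

End Ends.

Arguments cond {K Q} V c i.

(** * The quotients *)

Section Quotients.
Context {K : fieldType} {Q : quiver} (Qtree : is_tree Q) (Qoutward : eventually_outward Q).
Context (V : representation K Q).
Implicit Types (e g h : arrow Q) (E : virtual_arrow Q) (A B : csub Q).

Lemma connected_from (S : set Q) r :
  (forall i, S i -> exists p : route r i, visited p `<=` S) -> connected S.
Proof.
move=> Sr i j /Sr[p pS] /Sr[q qS]; exists (rcat (rrev p) q).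
by move=> v /visited_rcat[/visited_rrev/pS|/qS].
Qed.

Lemma cut_connected A e b : connected (A `&` side e b).
Proof.
move=> i j [Ai si] [Aj sj]; have [p pA] := csub_connected Ai Aj.
have [q [iq qp _]] := injective_route_of p.
have [q' [iq' q's]] := side_inj_route si sj.
(* The unique injective route stays both in [A] and on the side of [e]. *)
rewrite (injective_route_unique Qtree iq' iq) in q's.
by exists q => v qv; split; [exact: pA (qp _ qv)|exact: q's].
Qed.

Inductive downstream e : Q -> Prop :=
  | downstream_src : downstream e (src e)
  | downstream_step h : h <> e -> downstream e (src h) -> downstream e (tgt h).

Lemma downstream_behind e v : downstream e v -> behind e v.
Proof.
elim=> [|h ne _ s]; first exact: (side_endpoint e false).
exact: (@side_cross _ e false h false).
Qed.

Lemma downstream_full e v i : downstream e v -> full V (src e) i `<=` full V v i.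
Proof.
by elim=> [//|h ne _ IH]; apply: subset_trans IH _; exact: full_arrow.
Qed.

Lemma downstream_route e v : downstream e v ->
  exists p : route (src e) v, visited p `<=` downstream e.
Proof.
elim=> [|h ne hd [p pd]]; first by exists (stay (src e)) => _ ->; exact: downstream_src.
by exists (fwd p) => _ /= [/pd//|->]; exact: downstream_step.
Qed.

(** Behind an incoming boundary arrow [e], [A] is enlarged by everything that can
be reached from [src e] along arrows.  The new boundary arrows are incoming
and the new virtual arrows lie downstream of [src e], except for those that enter
[A], whose tails are ends of [A].  So all the new conditions are implied by being
in the transport of the full space at [src e]; [F V A i] lies there because [A]
has an end in front of [e]. *)
Lemma F_behind A e i x : is_end A (ArrowEnd e false) -> behind e i -> F V A i x ->
  exists B, csub_lt B A /\ F V B i x.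
Proof.
move=> cA bi xF; pose S : set Q := A `|` downstream e.
have Af : A `<=` front e := end_near cA.
have [At nAs] := cA.
have connS : connected S.
  apply: (@connected_from _ (tgt e)) => v [Av|/downstream_route[p pd]].
    by have [p pA] := csub_connected At Av; exists p => u /pA; left.
  exists (rcat (bwd (stay (tgt e))) p) => u /visited_rcat[[->|->]|/pd]; last by right.
  - by left.
  - by right; exact: downstream_src.
have [v0 Av0] := csub_nonempty A.
pose B := @Csub _ S (ex_intro _ v0 (or_introl Av0)) connS.
have BA : enhancement B A.
  exists e; split; first by split; [right; exact: downstream_src|left].
  apply/seteqP; split=> [v Av|v [[//|/downstream_behind bv] fv]].
    by split; [left|exact: Af].
  by case: (front_behind Qtree fv bv).
exists B; split; first by apply: t_step; right.
have xs : full V (src e) i x.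
  apply: (full_behind Qtree bi).
  have [c [cA' ce]] := exists_end Qtree Qoutward (b := true) At.
  by apply: (on_side_transport Qtree (b := true) ce) => //; move/(F_cond Qtree): xF; apply.
move/(F_cond Qtree): xF => xF; apply/(F_cond Qtree) => -[g d|E] cB.
  have [Bn nBf] := cB; have nAf : ~ csub_set A (endpoint g d) by move=> ?; apply: nBf; left.
  case: Bn => [An|dn]; first by apply: xF; split.
  have [ge|ne] := pselect (g = e).
    case: d cB nBf nAf dn => cB nBf nAf dn; first by case: nAf; rewrite ge.
    by case: nBf; right; rewrite ge; exact: downstream_src.
  case: d cB nBf nAf dn => cB nBf nAf dn.
    by case: nBf; right; exact: downstream_step.
  have [bgi|nbi] := pselect (side g false i); first by rewrite cond_beyond.
  by rewrite cond_near //; exact: (downstream_full dn xs).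
(* A virtual arrow that meets [A] stays in [A] from there on, and its tail is an
end of [A] with the same condition. *)
have [[z [dz Az]]|nE] := pselect (exists z, dom E z /\ csub_set A (at_ E z)); last first.
  have [z dz] := va_start E; apply: (full_Vvirtual Qtree dz).
  apply: (downstream_full _ xs); have /cB[Az|//] : walk_vertices E (at_ E z) by exists z.
  by case: nE; exists z.
have Atail y : dom E y -> z <= y -> csub_set A (at_ E y).
  move=> dy zy; apply: (va_ind _ dz dy zy Az) => h _ /cB[//|/downstream_behind bt] As.
  have [he|ne] := pselect (h = e); first by case: nAs; rewrite -he.
  case: (front_behind Qtree (Af _ As)); exact: (@side_cross _ e false h true).
have [E' E'P] := va_tail Qtree dz.
have cE' : is_end A (VirtualEnd E').
  by move=> _ [y dy <-]; have [y' [dy' zy' ->]] := E'P _ dy; exact: Atail.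
have /(VvirtualE Qtree)[y [dy xy]] := xF _ cE'.
have [y' [dy' _ yy']] := E'P _ dy.
by apply: (full_Vvirtual Qtree dy'); rewrite -yy'.
Qed.

Lemma subgroup_Fsum A i : subgroup (Fsum V A i).
Proof.
split.
  exists 0%N, (fun=> A), (fun=> 0); split; first by case.
  by rewrite big_ord0.
move=> _ _ [n [b [v [bv ->]]]] [m [b' [v' [bv' ->]]]].
exists (n + m)%N, (fun k => match fintype.split k with inl k => b k | inr k => b' k end),
  (fun k => match fintype.split k with inl k => v k | inr k => - v' k end); split.
  move=> k; case: (fintype.split k) => // l; have [lt Fv] := bv' l; split=> //.
  have [F0 FB] := subgroup_F Qtree V (b' l) i.
  by rewrite -(add0r (- _)); exact: FB.
rewrite big_split_ord /= -sumrN; congr (_ + _); apply: eq_bigr => k _.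
- by rewrite (unsplitK (inl k)).
- by rewrite (unsplitK (inr k)).
Qed.

Lemma F_Fsum A B i x : csub_lt B A -> F V B i x -> Fsum V A i x.
Proof.
move=> BA Bx; exists 1%N, (fun=> B), (fun=> x); split=> //.
by rewrite big_ord1.
Qed.

Lemma Fsum_F A i : Fsum V A i `<=` F V A i.
Proof.
move=> _ [n [b [v [bv ->]]]]; apply: subgroup_sum; first exact: subgroup_F.
by move=> k; have [lt] := bv k; exact: (F_lt Qtree Qoutward).
Qed.

Lemma Fsum_rmap A e x : Fsum V A (src e) x -> Fsum V A (tgt e) (rmap V e x).
Proof.
move=> [n [b [v [bv ->]]]]; exists n, b, (fun k => rmap V e (v k)).
split=> [k|]; last by rewrite raddf_sum.
by have [lt Fv] := bv k; split=> //; exact: F_rmap.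
Qed.

(** By the arrow that separates [i] from [A]: an outgoing one makes [F V A i]
vanish, an incoming one allows the enlargement of F_behind. *)
Lemma F_outside_Fsum A i x : ~ csub_set A i -> F V A i x -> Fsum V A i x.
Proof.
move=> /(separating_arrow Qtree)[g [d [cA si]]] xF; case: d cA si => cA si.
  by rewrite (F_outside Qtree cA si xF); case: (subgroup_Fsum A i).
by have [B [BA xB]] := F_behind cA si xF; exact: F_Fsum xB.
Qed.

(** The part beyond [g'] is connected and does not contain [g], whose near
endpoint is in [A]. *)
Lemma opposite_sides A g d g' d' : is_end A (ArrowEnd g d) ->
  is_end A (ArrowEnd g' d') -> g <> g' -> side g' d' `<=` side g (~~ d).
Proof.
move=> cA cA' ne; have [An' _] := cA'; have [An _] := cA.
apply: (connected_side (@side_connected _ g' d')) (side_endpoint _ _) _.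
  move=> /arrow_in_endpoint/(_ (~~ d)) s.
  by apply: (side_disj Qtree s); exact: (end_near cA').
rewrite -(negbK d'); apply: side_cross; first exact: not_eq_sym.
exact: (end_near cA).
Qed.

(** Two different boundary arrows cut off disjoint parts, each of which contains a
virtual arrow, and these are disjoint from the virtual arrows inside [A].  So one
virtual arrow behind [e] leaves room for one end of [A] behind [e] only. *)
Lemma unique_end A e c c' i : exactly_one_virtual_behind e ->
  is_end A c -> is_end A c' -> on_side e false c -> on_side e false c' ->
  cond V c i = cond V c' i.
Proof.
move=> [E0 [_ _ E0uniq]].
have same E E' : walk_vertices E `<=` behind e -> walk_vertices E' `<=` behind e ->
    same_virtual_arrow E E'.
  have to0 E1 : walk_vertices E1 `<=` behind e -> same_virtual_arrow E0 E1.
    by move=> bE; apply: E0uniq => //; exact: behind_virtual_behind.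
  by move=> /to0 s /to0; apply: rst_trans; exact: rst_sym.
have apart E E' g d : walk_vertices E `<=` behind e -> walk_vertices E' `<=` behind e ->
    walk_vertices E `<=` side g d -> walk_vertices E' `<=` side g (~~ d) -> False.
  move=> bE bE' sE sE'.
  have /(same_eventually (side g d) (same _ _ bE bE')) sE1 := eventually_in_sub sE.
  have [v [vs vs']] := eventually_in_meet sE1 (eventually_in_sub sE').
  exact: (side_disj Qtree vs vs').
have inner g d E' : is_end A (ArrowEnd g d) -> is_end A (VirtualEnd E') ->
    on_side e false (ArrowEnd g d) -> on_side e false (VirtualEnd E') -> False.
  move=> cA cE' [_ sub] /(eventually_behind Qtree) bE'.
  have [E sE] := @side_virtual _ Qtree Qoutward g d.
  apply: (apart E E' g d) => //; first exact: subset_trans sub.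
  exact: subset_trans (end_near cA).
case: c c' => [g d|E] [g' d'|E'] cA cA' ce ce'.
- have [gg|ne] := pselect (g = g').
    subst g'; case: (d =P d') => [->//|/neq_negb dd].
    by case: cA' => _; case; case: cA; rewrite dd negbK.
  have [E sE] := @side_virtual _ Qtree Qoutward g d.
  have [E' sE'] := @side_virtual _ Qtree Qoutward g' d'.
  case: ce ce' => [_ sub] [_ sub'].
  case: (apart E E' g d) => //; [exact: subset_trans sE sub|exact: subset_trans sE' sub'|].
  exact: subset_trans sE' (opposite_sides cA cA' ne).
- by case: (inner g d E').
- by case: (inner g' d' E).
- by apply: same_Vvirtual => //; apply: same; exact: (eventually_behind Qtree).
Qed.

(** With a single end behind [e], whose condition at [src e] is [L], and with
[R] the intersection of the conditions at [tgt e] from the ends in front of [e],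
the filtration is [L] intersected with the preimage of [R] at [src e] and the
image of [L] intersected with [R] at [tgt e]. *)
Lemma F_lift A e y : exactly_one_virtual_behind e -> arrow_in A e ->
  F V A (tgt e) y -> exists x, F V A (src e) x /\ rmap V e x = y.
Proof.
move=> one Ae /(F_cond Qtree) yF.
have [c0 [cA0 ce0]] := exists_end Qtree Qoutward (b := false) Ae.1.
have := yF _ cA0; rewrite (on_side_step Qtree V ce0) => -[x x0 xy].
exists x; split=> //; apply/(F_cond Qtree) => c cA.
case: (end_side Qtree true Ae cA) => ce; last by rewrite (unique_end _ one cA cA0 ce ce0).
by rewrite (on_side_step Qtree V ce) /cross /= xy; exact: yF.
Qed.

(** Each summand lifts: to [F V (b k)] if [b k] contains [e], and otherwise it is
zero. *)
Lemma Fsum_lift A e y : exactly_one_virtual_behind e -> arrow_in A e ->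
  Fsum V A (tgt e) y -> exists x, Fsum V A (src e) x /\ rmap V e x = y.
Proof.
move=> one Ae [n [b [v [bv ->]]]].
have /choice[u uP] : forall k, exists x, F V (b k) (src e) x /\ rmap V e x = v k.
  move=> k; have [lt vF] := bv k.
  case: (lt_loses Qtree lt Ae) => [be|[g [cB fg]]]; first exact: F_lift.
  exists 0; rewrite (F_outside Qtree cB fg vF) raddf0; split=> //.
  by case: (subgroup_F Qtree V (b k) (src e)).
exists (\sum_(k < n) u k); split; last first.
  by rewrite raddf_sum; apply: eq_bigr => k _; case: (uP k).
by exists n, b, u; split=> // k; have [lt _] := bv k; have [uF _] := uP k.
Qed.

(** An element killed by [rmap V e] satisfies the condition of the outgoing
boundary arrow [e] of the reduction of [A] along [e]. *)
Lemma F_kernel A e z : arrow_in A e -> F V A (src e) z -> rmap V e z = 0 ->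
  Fsum V A (src e) z.
Proof.
move=> Ae /(F_cond Qtree) zF ez.
have As : (A `&` behind e) (src e) by split; [case: Ae|exact: (side_endpoint e false)].
pose B := Csub (ex_intro _ _ As) (@cut_connected A e false).
apply: (@F_Fsum _ B); first by apply: t_step; left; exists e.
apply/(F_cond Qtree) => c cB.
case: (@end_cut _ A B e false c erefl cB) => [|->]; first exact: zF.
rewrite cond_near; last exact: (@endpoint_notin _ Qtree e false).
by rewrite (@transport_step _ _ Qtree V e true) ?transport_id //; exact: (side_endpoint e true).
Qed.

Lemma coset_eq (M : lmodType K) (N : set M) x y : subgroup N ->
  coset N x = coset N y <-> N (x - y).
Proof.
move=> gN; have [N0 subN] := gN; split=> [E|xy].
  have : coset N x x by rewrite /coset /= subrr.
  by rewrite E.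
apply/seteqP; split=> z /= zN; rewrite /coset /=.
- by rewrite -(subrKA x); exact: subgroupD.
- by rewrite -(subrKA y) -(opprB x y); exact: subN.
Qed.

Lemma Wmap_coset A e x :
  Wmap V A e (coset (Fsum V A (src e)) x) = coset (Fsum V A (tgt e)) (rmap V e x).
Proof.
have gN := subgroup_Fsum A (tgt e).
apply/seteqP; split=> y /=; last first.
  by move=> yx; exists x => //; rewrite /coset /= subrr; case: (subgroup_Fsum A (src e)).
move=> [x' xx' yx']; rewrite /coset /= -(subrKA (rmap V e x')).
by apply: subgroupD => //; rewrite -raddfB; exact: Fsum_rmap.
Qed.

End Quotients.

Unset Implicit Arguments.
Set Strict Implicit.

Theorem proposition5p1 (K : fieldType) (Q : quiver) (V : representation K Q)
    (Qtree : is_tree Q) (Qoutward : eventually_outward Q)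
    (Qbranched : finitely_branched Q) (alpha : csub Q) :
  (forall e : arrow Q, arrow_in alpha e -> exactly_one_virtual_behind e ->
     set_bij (W V alpha (src e)) (W V alpha (tgt e)) (Wmap V alpha e)) /\
  (forall i : Q, ~ csub_set alpha i -> W V alpha i = [set coset (Fsum V alpha i) 0]).
Proof.
split=> [e Ae one|i nAi]; last first.
  have gN := subgroup_Fsum Qtree V alpha i.
  apply/seteqP; split=> [_ [x xF <-]|_ ->].
    by apply/(coset_eq _ _ gN); rewrite subr0; exact: F_outside_Fsum.
  by exists 0 => //; case: (subgroup_F Qtree V alpha i).
have gS := subgroup_Fsum Qtree V alpha (src e).
have gT := subgroup_Fsum Qtree V alpha (tgt e).
split.
- move=> _ [x xF <-]; rewrite Wmap_coset //; exists (rmap V e x) => //; exact: F_rmap.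
- move=> c c' /set_mem[x xF <-] /set_mem[x' xF' <-].
  rewrite !Wmap_coset // => /(coset_eq _ _ gT); rewrite -raddfB.
  (* The difference of the representatives, minus a lift [u] of its image, is in
     the kernel. *)
  move=> /(Fsum_lift Qtree Qoutward one Ae)[u [uN ue]].
  apply/(coset_eq _ _ gS); rewrite -(subrK u (x - x')).
  apply: subgroupD => //; apply: F_kernel => //; last by rewrite raddfB /= ue subrr.
  have [_ subF] := subgroup_F Qtree V alpha (src e).
  by apply: (subF); [exact: subF|exact: Fsum_F].
- move=> _ [y yF <-]; have [x [xF <-]] := F_lift Qtree Qoutward one Ae yF.
  exists (coset (Fsum V alpha (src e)) x); first by exists x.
  exact: Wmap_coset.
Qed.
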